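(* Let $\mathfrak g$ be an abelian restricted Lie algebra over $\mathbb F$ and $M$ a restricted $\mathfrak g$-module, with $\dim_{\mathbb F}\mathfrak g=n$ and $\dim_{\mathbb F}M=m$ finite. Then for every $k\ge 0$ the space $C^k(\mathfrak g;M)$ of $k$-dimensional cochains of $\mathfrak g$ with coefficients in $M$ has dimension $$\binom{n+k-1}{k}\cdot m.$$ In particular, the dimension of $C^k(\mathfrak g;\mathbb F)$ is the same as that of the $k$-th symmetric power $S^k\mathfrak g$.
   Context: $\mathbb F$ is a field of characteristic $p>0$ whose Frobenius map $\lambda\mapsto\lambda^p$ is an automorphism. An abelian restricted Lie algebra is a vector space $\mathfrak g$ over $\mathbb F$ with zero bracket and a map $g\mapsto g^{[p]}$ on $\mathfrak g$ with $(\lambda g)^{[p]}=\lambda^pg^{[p]}$ and $(g+h)^{[p]}=g^{[p]}+h^{[p]}$. Its restricted universal enveloping algebra $U_{\rm res.}(\mathfrak g)$ is the quotient of the universal enveloping algebra $U(\mathfrak g)$ by the two-sided ideal generated by all $g^{[p]}-g^p$, $g\in\mathfrak g$. A restricted $\mathfrak g$-module is a $\mathfrak g$-module $M$ with $g^{[p]}x=g^px$ for all $g\in\mathfrak g,x\in M$; equivalently a unital $U_{\rm res.}(\mathfrak g)$-module. $\mathbb F$ is the trivial module. $\overline{\mathfrak g}$ denotes the abelian group $\mathfrak g$ with scalar multiplication in which $\lambda\in\mathbb F$ acts on $v$ as $\lambda^{1/p}v$. Put $$C_k=\bigoplus_{2t+s=k}S^t\overline{\mathfrak g}\otimes_{\mathbb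 F}\Lambda^s\mathfrak g\otimes_{\mathbb F}U_{\rm res.}(\mathfrak g),$$ a free $U_{\rm res.}(\mathfrak g)$-module via the last factor. The space of $k$-dimensional cochains is $$C^k(\mathfrak g;M)=\operatorname{Hom}_{U_{\rm res.}(\mathfrak g)}(C_k,M)=\bigoplus_{2t+s=k}\operatorname{Hom}_{\mathbb F}(S^t\overline{\mathfrak g}\otimes\Lambda^s\mathfrak g,M).$$ *)

(* Defs.v *)
From HB Require Import structures.
From mathcomp Require Import all_fingroup all_boot all_algebra.
From mathcomp Require Import finmap monalg.
From mathcomp Require Import boolp functions.

Set Implicit Arguments.
Unset Strict Implicit.
Unset Printing Implicit Defensive.

Import GRing.Theory.
Local Open Scope quotient_scope.
Local Open Scope ring_scope.

Definition has_dim (F : fieldType) (V : lmodType F) (d : nat) : Prop :=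
  inhabited (Vector.axiom d V).

Lemma lin0 (R : pzRingType) (U V : lmodType R) (f : U -> V) :
  linear f -> f 0 = 0.
Proof. by move=> fl; have := fl (-1) 0 0; rewrite scaler0 addr0 scaleN1r addNr. Qed.

Lemma linZ (R : pzRingType) (U V : lmodType R) (f : U -> V) :
  linear f -> forall a x, f (a *: x) = a *: f x.
Proof. by move=> fl a x; have := fl a x 0; rewrite (lin0 fl) !addr0. Qed.

Lemma linD (R : pzRingType) (U V : lmodType R) (f : U -> V) :
  linear f -> {morph f : x y / x + y}.
Proof. by move=> fl x y; have := fl 1 x y; rewrite !scale1r. Qed.

(* Key sealing the operations below against unwanted unfolding *)
Fact quot_key : unit. Proof. by []. Qed.

Section Span.
Context (R : pzRingType) (V : lmodType R) (A : V -> Prop).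

Definition span_pred : {pred V} := fun v =>
  `[< exists2 s : seq (R * V), (forall x, x \in s -> A x.2)
      & v = \sum_(x <- s) x.1 *: x.2 >].

Fact span_submod : submod_closed span_pred.
Proof.
split; first by apply/asboolP; exists [::] => //; rewrite big_nil.
move=> a v w /asboolP[s sA ->] /asboolP[t tA ->]; apply/asboolP.
exists ([seq (a * x.1, x.2) | x <- s] ++ t).
  by move=> x; rewrite mem_cat => /orP[/mapP[y /sA Ay ->]|/tA].
rewrite big_cat big_map scaler_sumr /=; congr (_ + _).
by apply: eq_bigr => x _; rewrite scalerA.
Qed.
HB.instance Definition _ := GRing.isSubmodClosed.Build R V span_pred span_submod.

Lemma mem_span v : A v -> v \in span_pred.
Proof.
move=> Av; apply/asboolP; exists [:: (1, v)].
  by move=> x; rewrite inE => /eqP ->.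
by rewrite big_seq1 scale1r.
Qed.

End Span.

Section ModuleQuotient.
Context (R : pzRingType) (V : lmodType R) (A : V -> Prop).

Definition lquot := Quotient.quot (span_pred A).

HB.instance Definition _ := GRing.Zmodule.on lquot.
HB.instance Definition _ := EqQuotient.on lquot.

Definition lquot_pi (v : V) : lquot := \pi v.
Definition lquot_scale : R -> lquot -> lquot :=
  locked_with quot_key (fun a q => lquot_pi (a *: repr q)).

Lemma lquot_eqP (v w : V) : reflect (lquot_pi v = lquot_pi w) (v - w \in span_pred A).
Proof. by rewrite Quotient.idealrBE; apply: eqP. Qed.

Lemma lquot_piK (q : lquot) : lquot_pi (repr q) = q.
Proof. exact: reprK. Qed.

Lemma repr_lquot (v : V) : repr (lquot_pi v) - v \in span_pred A.
Proof. by apply/lquot_eqP; rewrite lquot_piK. Qed.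

Lemma lquot_piD : {morph lquot_pi : v w / v + w}.
Proof. by move=> v w; rewrite /lquot_pi raddfD. Qed.

Lemma lquot_piZ a v : lquot_pi (a *: v) = lquot_scale a (lquot_pi v).
Proof.
rewrite /lquot_scale locked_withE.
by apply/esym/lquot_eqP; rewrite -scalerBr rpredZ // repr_lquot.
Qed.

Fact lquot_scaleA a b q :
  lquot_scale a (lquot_scale b q) = lquot_scale (a * b) q.
Proof. by rewrite -[q]lquot_piK -!lquot_piZ scalerA. Qed.
Fact lquot_scale1 : left_id 1 lquot_scale.
Proof. by move=> q; rewrite -[q]lquot_piK -!lquot_piZ scale1r. Qed.
Fact lquot_scaleDr : right_distributive lquot_scale +%R.
Proof.
move=> a q r; rewrite -[q]lquot_piK -[r]lquot_piK -lquot_piD -!lquot_piZ.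
by rewrite scalerDr lquot_piD.
Qed.
Fact lquot_scaleDl q : {morph lquot_scale^~ q : a b / a + b}.
Proof.
by move=> a b; rewrite -[q]lquot_piK -!lquot_piZ scalerDl lquot_piD.
Qed.

HB.instance Definition _ := GRing.Zmodule_isLmodule.Build R lquot
  lquot_scaleA lquot_scale1 lquot_scaleDr lquot_scaleDl.

Fact lquot_pi_linear : linear lquot_pi.
Proof. by move=> a v w; rewrite lquot_piD lquot_piZ. Qed.
HB.instance Definition _ :=
  GRing.isLinear.Build R V lquot *:%R lquot_pi lquot_pi_linear.

End ModuleQuotient.

Notation "V %/span A" := (@lquot _ V A)
  (at level 40, no associativity, format "V  %/span  A").

(* The linear extension to the free module {malg F[K]} of a map on K *)
Definition lext (F : fieldType) (K : choiceType) (N : lmodType F) (h : K -> N)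
  (z : {malg F[K]}) : N := \sum_(k <- msupp z) z@_k *: h k.

Section Lext.
Context (F : fieldType) (K : choiceType) (N : lmodType F) (h : K -> N).

Lemma lextEw (d : {fset K}) (z : {malg F[K]}) : (msupp z `<=` d)%fset ->
  lext h z = \sum_(k <- d) z@_k *: h k.
Proof.
move=> le; rewrite /lext (big_fset_incl _ le) //= => x xd /mcoeff_outdom ->.
by rewrite scale0r.
Qed.

Lemma lext_linear : linear (lext h).
Proof.
move=> a y z; pose d := (msupp y `|` msupp z)%fset.
have yd : (msupp y `<=` d)%fset by apply: fsubsetUl.
have zd : (msupp z `<=` d)%fset by apply: fsubsetUr.
have ad : (msupp (a *: y + z) `<=` d)%fset.
  by apply: (fsubset_trans (msuppD_le _ _)); rewrite fsetSU // msuppZ_le.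
rewrite !(lextEw yd, lextEw zd, lextEw ad) scaler_sumr -big_split /=.
by apply: eq_bigr => k _; rewrite mcoeffD mcoeffZ scalerDl scalerA.
Qed.
HB.instance Definition _ :=
  GRing.isLinear.Build F {malg F[K]} N *:%R (lext h) lext_linear.

Lemma lextU k : lext h << k >> = h k.
Proof.
by rewrite (lextEw msuppU_le) big_seq_fset1 mcoeffUU scale1r.
Qed.

End Lext.

Lemma malgUZ (F : fieldType) (K : choiceType) (c : F) (k : K) :
  << c *g k >> = c *: << k >> :> {malg F[K]}.
Proof. by apply/malgP => l; rewrite mcoeffZ !mcoeffU mulrnAr mulr1. Qed.

Lemma malg_ext (F : fieldType) (K : choiceType) (N : lmodType F)
    (f g : {linear {malg F[K]} -> N}) :
  (forall k, f << k >> = g << k >>) -> f =1 g.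
Proof.
move=> fg z; rewrite [z]monalgE !linear_sum; apply: eq_bigr => k _ /=.
by rewrite malgUZ !linearZ fg.
Qed.

Section Tensor.
Context (F : fieldType) (V W : lmodType F).
Local Notation "v ** w" := (<< (v, w) >> : {malg F[(V * W)%type]})
  (at level 40).

Variant bilin_rel : {malg F[(V * W)%type]} -> Prop :=
| BilinL a v v' w : bilin_rel ((a *: v + v') ** w - (a *: (v ** w) + v' ** w))
| BilinR a v w w' : bilin_rel (v ** (a *: w + w') - (a *: (v ** w) + v ** w')).

Definition tensor := {malg F[(V * W)%type]} %/span bilin_rel.
HB.instance Definition _ := GRing.Lmodule.on tensor.

Definition tens : V -> W -> tensor :=
  locked_with quot_key (fun v w => lquot_pi _ (v ** w)).

Definition tensor_lift (N : lmodType F) (h : V -> W -> N) (z : tensor) : N :=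
  lext (fun x => h x.1 x.2) (repr z).

Lemma tens_linearr v : linear (tens v).
Proof.
move=> a w w'; rewrite /tens locked_withE -linearP; apply/lquot_eqP.
apply: mem_span; exact: BilinR.
Qed.
Lemma tens_linearl w : linear (tens^~ w).
Proof.
move=> a v v'; rewrite /tens locked_withE -linearP; apply/lquot_eqP.
apply: mem_span; exact: BilinL.
Qed.

Section Lift.
Context (N : lmodType F) (h : V -> W -> N).
Hypotheses (hl : forall w, linear (h^~ w)) (hr : forall v, linear (h v)).

Lemma lext_span z : z \in span_pred bilin_rel ->
  lext (fun x => h x.1 x.2) z = 0.
Proof.
move=> /asboolP[s sA ->]; rewrite linear_sum big_seq big1 // => x /sA Ax.
rewrite linearZ /=; apply/eqP; rewrite scaler_eq0; apply/orP; right.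
by case: Ax => [a v v' w|a v w w'];
  rewrite linearB linearP /= !lextU /= ?(hl, hr) subrr.
Qed.

Lemma tensor_lift_pi z :
  tensor_lift h (lquot_pi _ z) = lext (fun x => h x.1 x.2) z.
Proof.
apply: subr0_eq; rewrite /tensor_lift -linearB /=; exact/lext_span/repr_lquot.
Qed.

Lemma tensor_liftE v w : tensor_lift h (tens v w) = h v w.
Proof. by rewrite /tens locked_withE tensor_lift_pi lextU. Qed.

Lemma tensor_lift_linear : linear (tensor_lift h).
Proof.
move=> a y z; rewrite -[y]lquot_piK -[z]lquot_piK -linearP !tensor_lift_pi.
by rewrite linearP.
Qed.
End Lift.

Lemma tensor_ext (N : zmodType) (f g : tensor -> N) :
  {morph f : x y / x + y} -> {morph g : x y / x + y} ->
  (forall v w, f (tens v w) = g (tens v w)) -> f =1 g.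
Proof.
move=> fD gD fg z; rewrite -[z]lquot_piK [repr z]monalgE.
have f0 : f 0 = 0 by apply: (addrI (f 0)); rewrite -fD !addr0.
have g0 : g 0 = 0 by apply: (addrI (g 0)); rewrite -gD !addr0.
elim/big_ind: _ => [|x y|[v w] _]; first by rewrite (lin0 (@lquot_pi_linear _ _ _)) f0 g0.
  by rewrite lquot_piD fD gD => -> ->.
rewrite malgUZ; set a := (repr z)@_(v, w).
have -> : lquot_pi bilin_rel (a *: << (v, w) >>) = tens (a *: v) w.
  by rewrite lquot_piZ (linZ (tens_linearl w)) /tens locked_withE.
exact: fg.
Qed.

End Tensor.

Section Powers.
Context (F : fieldType) (t : nat) (V : lmodType F).
Implicit Type w : {ffun 'I_t -> V}.

Definition subst_at w (i : 'I_t) (v : V) : {ffun 'I_t -> V} :=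
  [ffun j => if j == i then v else w j].

Variant multilin_rel : {malg F[{ffun 'I_t -> V}]} -> Prop :=
| Multilin w i a u v :
    multilin_rel (<< subst_at w i (a *: u + v) >>
                  - (a *: << subst_at w i u >> + << subst_at w i v >>)).

Definition tpow := {malg F[{ffun 'I_t -> V}]} %/span multilin_rel.
HB.instance Definition _ := GRing.Lmodule.on tpow.

Definition tprod : {ffun 'I_t -> V} -> tpow :=
  locked_with quot_key (fun w => lquot_pi _ << w >>).

Variant sym_rel : tpow -> Prop :=
| SymRel w (s : 'S_t) : sym_rel (tprod [ffun i => w (s i)] - tprod w).

Variant alt_rel : tpow -> Prop :=
| AltRel w i j : i != j -> w i = w j -> alt_rel (tprod w).

Definition SymPow := tpow %/span sym_rel.
Definition ExtPow := tpow %/span alt_rel.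

HB.instance Definition _ := GRing.Lmodule.on SymPow.
HB.instance Definition _ := GRing.Lmodule.on ExtPow.

End Powers.

Section AlgQuotient.
Context (F : fieldType) (A : algType F) (S : A -> Prop).

Variant ideal_gen : A -> Prop := IdealGen a x b : S x -> ideal_gen (a * x * b).

Local Notation ideal := (span_pred ideal_gen).

Lemma mem_ideal x : S x -> x \in ideal.
Proof.
by move=> Sx; apply: mem_span; rewrite -[x]mul1r -[1 * x]mulr1; exact: IdealGen.
Qed.

Lemma ideal_mull c x : x \in ideal -> c * x \in ideal.
Proof.
move=> /asboolP[s sS ->]; rewrite mulr_sumr big_seq; apply: rpred_sum => y /sS.
case: y => k y /= [a z b Sz]; rewrite -scalerAr rpredZ // !mulrA.
by apply: mem_span; exact: IdealGen.
Qed.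

Lemma ideal_mulr c x : x \in ideal -> x * c \in ideal.
Proof.
move=> /asboolP[s sS ->]; rewrite mulr_suml big_seq; apply: rpred_sum => y /sS.
case: y => k y /= [a z b Sz]; rewrite -scalerAl rpredZ // -(mulrA (a * z)).
by apply: mem_span; exact: IdealGen.
Qed.

(* algType excludes the zero algebra, whence the properness hypothesis *)
Definition algquot of 1 \notin ideal := A %/span ideal_gen.

Hypothesis S_proper : 1 \notin ideal.
Local Notation Q := (algquot S_proper).
HB.instance Definition _ := GRing.Lmodule.on Q.

Definition algquot_pi (x : A) : Q := lquot_pi _ x.
Definition algquot_mul : Q -> Q -> Q :=
  locked_with quot_key (fun q r => algquot_pi (repr q * repr r)).

Lemma algquot_mulE x y : algquot_pi (x * y) = algquot_mul (algquot_pi x) (algquot_pi y).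
Proof.
rewrite /algquot_mul locked_withE; apply/esym/lquot_eqP.
rewrite -(subrK (repr (algquot_pi x) * y) (_ * _)) -mulrBr -addrA -mulrBl.
by apply: rpredD; [apply: ideal_mull|apply: ideal_mulr]; apply: repr_lquot.
Qed.
Lemma algquot_piK (q : Q) : algquot_pi (repr q) = q.
Proof. exact: lquot_piK. Qed.
Lemma algquot_pi_linear : linear algquot_pi.
Proof. exact: lquot_pi_linear. Qed.
HB.instance Definition _ :=
  GRing.isLinear.Build F A Q *:%R algquot_pi algquot_pi_linear.
Let piK := algquot_piK.
Let piD := linD algquot_pi_linear.
Let piZ := linZ algquot_pi_linear.

Fact algquot_mulA : associative algquot_mul.
Proof.
by move=> q r s; rewrite -[q]piK -[r]piK -[s]piK -!algquot_mulE mulrA.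
Qed.
Fact algquot_mul1l : left_id (algquot_pi 1) algquot_mul.
Proof. by move=> q; rewrite -[q]piK -!algquot_mulE mul1r. Qed.
Fact algquot_mul1r : right_id (algquot_pi 1) algquot_mul.
Proof. by move=> q; rewrite -[q]piK -!algquot_mulE mulr1. Qed.
Fact algquot_mulDl : left_distributive algquot_mul +%R.
Proof.
move=> q r s; rewrite -[q]piK -[r]piK -[s]piK -piD -!algquot_mulE mulrDl.
by rewrite piD.
Qed.
Fact algquot_mulDr : right_distributive algquot_mul +%R.
Proof.
move=> q r s; rewrite -[q]piK -[r]piK -[s]piK -piD -!algquot_mulE mulrDr.
by rewrite piD.
Qed.

Fact algquot_1neq0 : algquot_pi 1 != 0.
Proof.
apply: contra S_proper => /eqP; rewrite -(lin0 (@lquot_pi_linear _ _ ideal_gen)).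
by move/lquot_eqP; rewrite subr0.
Qed.

HB.instance Definition _ := GRing.Zmodule_isNzRing.Build Q
  algquot_mulA algquot_mul1l algquot_mul1r algquot_mulDl algquot_mulDr
  algquot_1neq0.

Lemma algquot_piM x y : algquot_pi (x * y) = algquot_pi x * algquot_pi y.
Proof. exact: algquot_mulE. Qed.

Fact algquot_scaleAl (a : F) (q r : Q) : a *: (q * r) = (a *: q) * r.
Proof.
rewrite -[q]piK -[r]piK -(piZ a (repr q)) -!algquot_piM.
by rewrite -(piZ a (_ * _)) scalerAl.
Qed.
Fact algquot_scaleAr (a : F) (q r : Q) : a *: (q * r) = q * (a *: r).
Proof.
rewrite -[q]piK -[r]piK -(piZ a (repr r)) -!algquot_piM.
by rewrite -(piZ a (_ * _)) scalerAr.
Qed.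
HB.instance Definition _ :=
  GRing.Lmodule_isLalgebra.Build F Q algquot_scaleAl.
HB.instance Definition _ :=
  GRing.Lalgebra_isAlgebra.Build F Q algquot_scaleAr.

End AlgQuotient.

(* Unital left A-module structures on a vector space, as actions *)
Notation ideal S := (span_pred (ideal_gen S)).

Section AlgAction.
Context (F : fieldType) (M : lmodType F).

Record alg_action (A : algType F) (act : A -> M -> M) : Prop := AlgAction {
  alg_actPl : forall x, linear (act^~ x);
  alg_actPr : forall a, linear (act a);
  alg_act1 : forall x, act 1 x = x;
  alg_actM : forall a b x, act (a * b) x = act a (act b x)
}.

Lemma alg_actB (A : algType F) (act : A -> M -> M) : alg_action act ->
  forall a b m, act (a - b) m = act a m - act b m.
Proof.
by move=> aP a b m; rewrite -[- b]scaleN1r [a + _]addrC (alg_actPl aP) scaleN1r addrC.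
Qed.

Lemma alg_actX (A : algType F) (act : A -> M -> M) : alg_action act ->
  forall a n m, act (a ^+ n) m = iter n (act a) m.
Proof.
move=> aP a n m; elim: n => [|n IHn]; first by rewrite expr0 (alg_act1 aP).
by rewrite exprS (alg_actM aP) IHn.
Qed.

Section QuotAct.
Context (A : algType F) (S : A -> Prop) (act : A -> M -> M).
Hypothesis actP : alg_action act.
Hypothesis actS : forall s, S s -> forall x, act s x = 0.

Let act0l x : act 0 x = 0.
Proof. exact: lin0 (alg_actPl actP x). Qed.
Let act0r a : act a 0 = 0.
Proof. exact: lin0 (alg_actPr actP a). Qed.
Let actDl a b x : act (a + b) x = act a x + act b x.
Proof. exact: linD (alg_actPl actP x) a b. Qed.

Lemma ideal_act0 a x : a \in ideal S -> act a x = 0.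
Proof.
move=> /asboolP[s sS ->]; rewrite big_seq.
elim/big_ind: _ => // [b c b0 c0|[k y] /sS /= [b z c Sz]].
  by rewrite actDl b0 c0 addr0.
rewrite -[k *: _]addr0 (alg_actPl actP) act0l addr0 !(alg_actM actP).
by rewrite (actS Sz) act0r scaler0.
Qed.

Lemma proper_ideal_act (x : M) : x != 0 -> 1 \notin ideal S.
Proof.
move=> x_neq0; apply/negP => one_in; case/eqP: x_neq0.
by rewrite -(alg_act1 actP x) ideal_act0.
Qed.

Hypothesis S_proper : 1 \notin ideal S.

Definition quot_act (q : algquot S_proper) : M -> M := act (repr q).

Lemma quot_actE a x : quot_act (algquot_pi S_proper a) x = act a x.
Proof.
rewrite /quot_act; rewrite -(subrK a (repr (algquot_pi S_proper a))) actDl ideal_act0 ?add0r //.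
exact: repr_lquot.
Qed.

Lemma quot_actP : alg_action quot_act.
Proof.
split.
- move=> x a q r; rewrite -[q]algquot_piK -[r]algquot_piK -algquot_pi_linear !quot_actE.
  exact: (alg_actPl actP).
- by move=> q; exact: (alg_actPr actP (repr q)).
- by move=> x; rewrite quot_actE (alg_act1 actP).
- move=> q r x; rewrite -[q]algquot_piK -[r]algquot_piK.
  by rewrite -algquot_piM !quot_actE (alg_actM actP).
Qed.
End QuotAct.
End AlgAction.

Section FreeAlgebra.
Context (F : fieldType) (X : choiceType).

Fact freealg_scaleAr (a : F) (x y : {malg F[{fmonom X}]}) :
  a *: (x * y) = x * (a *: y).
Proof.
apply/malgP => k; rewrite [LHS]mcoeffZ [X in _ * X = _]mcoeffMl.
rewrite (@mcoeffMlw _ _ _ _ x (a *: y) k (fsubset_refl _) (msuppZ_le a y)).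
rewrite mulr_sumr; apply: eq_bigr => i _.
rewrite mulr_sumr; apply: eq_bigr => j _.
by rewrite mcoeffZ mulrnAr mulrCA.
Qed.
Definition freealg := {malg F[{fmonom X}]}.
HB.instance Definition _ := GRing.Lalgebra.on freealg.
HB.instance Definition _ :=
  GRing.Lalgebra_isAlgebra.Build F freealg freealg_scaleAr.

Definition freegen : X -> freealg := locked_with quot_key (fun x => << fmu x >>).

Section FreeAct.
Context (M : lmodType F) (f : X -> M -> M).
Definition free_act (a : freealg) (m : M) : M :=
  lext (fun w : {fmonom X} => foldr f m w) a.

Hypothesis f_linear : forall x, linear (f x).

Lemma free_act_gen x m : free_act (freegen x) m = f x m.
Proof. by rewrite /free_act /freegen locked_withE lextU fmuE. Qed.

Lemma free_actP : alg_action free_act.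
Proof.
have fold_lin (w : {fmonom X}) : linear (fun m => foldr f m w).
  by case: w => w a m n /=; elim: w => //= x w ->; rewrite f_linear.
split=> [m|a b m n|m|a b m].
- exact: lext_linear.
- rewrite /free_act /lext scaler_sumr -big_split /=; apply: eq_bigr => w _.
  by rewrite fold_lin scalerDr !scalerA mulrC.
- by rewrite /free_act lextU fm1.
- rewrite /free_act malgME (linear_sum (lext _)) /= {2}/lext; apply: eq_bigr => v _.
  rewrite (linear_sum (lext _)) /=.
  have fv_lin := fold_lin v.
  rewrite [in RHS]/lext (big_morph _ (linD fv_lin) (lin0 fv_lin)) scaler_sumr.
  apply: eq_bigr => w _; rewrite (linZ fv_lin) scalerA.
  rewrite malgUZ (linZ (lext_linear _)) lextU; congr (_ *: _).
  have -> : mmul v w = FMonom (v ++ w) by exact: fmmulE.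
  by rewrite foldr_cat.
Qed.
End FreeAct.

End FreeAlgebra.

(* The tensor product of X and U as a left U-module via the last factor *)
Section FreeOn.
Context (F : fieldType) (U : algType F) (X : lmodType F).

Definition freeon : Type := tensor X U.
HB.instance Definition _ := GRing.Zmodule.on freeon.

Definition freeon_scale (u : U) (z : freeon) : freeon :=
  tensor_lift (fun x v => tens x (u * v)) z.

Let bil (u : U) (x : X) : linear (fun v => tens x (u * v)).
Proof. by move=> a v w; rewrite mulrDr -scalerAr tens_linearr. Qed.
Let bir (u : U) (v : U) : linear (fun x : X => tens x (u * v)).
Proof. exact: tens_linearl. Qed.

Lemma freeon_scaleE u x v : freeon_scale u (tens x v) = tens x (u * v).
Proof. by rewrite /freeon_scale tensor_liftE. Qed.

Fact freeon_scaleDr : right_distributive freeon_scale +%R.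
Proof. by move=> u; apply: linD; apply: tensor_lift_linear. Qed.
Fact freeon_scaleA u v z :
  freeon_scale u (freeon_scale v z) = freeon_scale (u * v) z.
Proof.
move: z; apply: (@tensor_ext _ _ _ _
  (fun z => freeon_scale u (freeon_scale v z)) (freeon_scale (u * v))).
- by move=> y z; rewrite !freeon_scaleDr.
- by move=> y z; rewrite freeon_scaleDr.
- by move=> x w; rewrite !freeon_scaleE mulrA.
Qed.
Fact freeon_scale1 : left_id 1 freeon_scale.
Proof.
apply: (@tensor_ext _ _ _ _ (freeon_scale 1) id) => [y z|y z|x w] //.
  by rewrite freeon_scaleDr.
by rewrite freeon_scaleE mul1r.
Qed.
Fact freeon_scaleDl z : {morph freeon_scale^~ z : u v / u + v}.
Proof.
move=> u v; move: z.
apply: (@tensor_ext _ _ _ _ (freeon_scale (u + v))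
  (fun z => freeon_scale u z + freeon_scale v z)) => [y z|y z|x w].
- by rewrite freeon_scaleDr.
- by rewrite (freeon_scaleDr u y z) (freeon_scaleDr v y z); exact: addrACA.
- by rewrite !freeon_scaleE mulrDl (linD (tens_linearr x)).
Qed.
HB.instance Definition _ := GRing.Zmodule_isLmodule.Build U freeon
  freeon_scaleA freeon_scale1 freeon_scaleDr freeon_scaleDl.
End FreeOn.

(* Families over a finite index type, so that sum and product agree *)
Section DirectSum.
Context (R : pzRingType) (I : finType) (V : I -> lmodType R).

Definition dirsum : Type := forall i, V i.
HB.instance Definition _ := Choice.on dirsum.
Implicit Types f g h : dirsum.

Let add f g : dirsum := fun i => f i + g i.
Let opp f : dirsum := fun i => - f i.
Let zero : dirsum := fun i => 0.
Let scale (a : R) f : dirsum := fun i => a *: f i.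

Fact dirsum_addA : associative add.
Proof. by move=> f g h; apply: functional_extensionality_dep => i; apply: addrA. Qed.
Fact dirsum_addC : commutative add.
Proof. by move=> f g; apply: functional_extensionality_dep => i; apply: addrC. Qed.
Fact dirsum_add0 : left_id zero add.
Proof. by move=> f; apply: functional_extensionality_dep => i; apply: add0r. Qed.
Fact dirsum_addN : left_inverse zero opp add.
Proof. by move=> f; apply: functional_extensionality_dep => i; apply: addNr. Qed.
HB.instance Definition _ := GRing.isZmodule.Build dirsum
  dirsum_addA dirsum_addC dirsum_add0 dirsum_addN.

Fact dirsum_scaleA a b f : scale a (scale b f) = scale (a * b) f.
Proof. by apply: functional_extensionality_dep => i; apply: scalerA. Qed.
Fact dirsum_scale1 : left_id 1 scale.
Proof. by move=> f; apply: functional_extensionality_dep => i; apply: scale1r. Qed.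
Fact dirsum_scaleDr : right_distributive scale +%R.
Proof. by move=> a f g; apply: functional_extensionality_dep => i; apply: scalerDr. Qed.
Fact dirsum_scaleDl f : {morph scale^~ f : a b / a + b}.
Proof. by move=> a b; apply: functional_extensionality_dep => i; apply: scalerDl. Qed.
HB.instance Definition _ := GRing.Zmodule_isLmodule.Build R dirsum
  dirsum_scaleA dirsum_scale1 dirsum_scaleDr dirsum_scaleDl.
End DirectSum.

Section Twist.
Context (F : fieldType) (p : nat) (charF : p \in [pchar F]).
Context (frobB : bijective (pFrobenius_aut charF)).

Fact proot_subproof : exists r : F -> F,
  cancel (pFrobenius_aut charF) r /\ cancel r (pFrobenius_aut charF).
Proof. by case: frobB => r rK Kr; exists r. Qed.

Definition proot : F -> F := sval (cid proot_subproof).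

Lemma prootK : cancel proot (pFrobenius_aut charF).
Proof. by rewrite /proot; case: cid => r []. Qed.

Let Finj := bij_inj frobB.

Fact proot1 : proot 1 = 1.
Proof. by apply: Finj; rewrite prootK pFrobenius_aut1. Qed.
Fact prootM : {morph proot : a b / a * b}.
Proof.
move=> a b; apply: Finj.
by rewrite pFrobenius_autM_comm ?prootK //; exact: mulrC.
Qed.
Fact prootD : {morph proot : a b / a + b}.
Proof.
move=> a b; apply: Finj.
by rewrite pFrobenius_autD_comm ?prootK //; exact: mulrC.
Qed.

Context (V : lmodType F).
Definition twist of bijective (pFrobenius_aut charF) : Type := V.
Local Notation Vbar := (twist frobB).
HB.instance Definition _ := GRing.Zmodule.copy Vbar V.

Definition twist_scale (a : F) (v : Vbar) : Vbar := proot a *: (v : V).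

Fact twist_scaleA a b v : twist_scale a (twist_scale b v) = twist_scale (a * b) v.
Proof. by rewrite /twist_scale scalerA prootM. Qed.
Fact twist_scale1 : left_id 1 twist_scale.
Proof. by move=> v; rewrite /twist_scale proot1; apply: scale1r. Qed.
Fact twist_scaleDr : right_distributive twist_scale +%R.
Proof. by move=> a v w; apply: scalerDr. Qed.
Fact twist_scaleDl v : {morph twist_scale^~ v : a b / a + b}.
Proof. by move=> a b; rewrite /twist_scale prootD; apply: scalerDl. Qed.
HB.instance Definition _ := GRing.Zmodule_isLmodule.Build F Vbar
  twist_scaleA twist_scale1 twist_scaleDr twist_scaleDl.
End Twist.

Section RestrictedLie.
Context (F : fieldType) (p : nat).

(* The bracket is zero, see lie_bracket; rl_pop x is x^[p] *)
Record abrLieAlg := AbrLieAlg {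
  rl_sort :> lmodType F;
  rl_pop : rl_sort -> rl_sort;
  rl_popZ : forall a x, rl_pop (a *: x) = a ^+ p *: rl_pop x;
  rl_popD : {morph rl_pop : x y / x + y}
}.

Definition lie_bracket (g : abrLieAlg) (x y : g) : g := 0.

Record resModule (g : abrLieAlg) := ResModule {
  rm_sort :> lmodType F;
  rm_act : g -> rm_sort -> rm_sort;
  rm_actl : forall m, linear (rm_act^~ m);
  rm_actr : forall x, linear (rm_act x);
  rm_act_bracket : forall x y m,
    rm_act (lie_bracket x y) m
    = rm_act x (rm_act y m) - rm_act y (rm_act x m);
  rm_act_pop : forall x m, rm_act (rl_pop x) m = iter p (rm_act x) m
}.

Context (charF : p \in [pchar F]) (g : abrLieAlg).

Section TrivialModule.
Let act (x : g) (m : F^o) : F^o := 0.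

Fact triv_actl m : linear (act^~ m).
Proof. by move=> a x y; rewrite /act scaler0 addr0. Qed.
Fact triv_actr x : linear (act x).
Proof. by move=> a m n; rewrite /act scaler0 addr0. Qed.
Fact triv_act_bracket x y m :
  act (lie_bracket x y) m = act x (act y m) - act y (act x m).
Proof. by rewrite /act subrr. Qed.
Fact triv_act_pop x m : act (rl_pop x) m = iter p (act x) m.
Proof. by case: p (prime_gt0 (pcharf_prime charF)). Qed.

Definition trivial_module : resModule g :=
  @ResModule g F^o act triv_actl triv_actr triv_act_bracket triv_act_pop.
End TrivialModule.

(* The tensor algebra and the enveloping algebras act on every restricted
   module; the trivial module witnesses the properness of their ideals. *)

Section TensorAlgebra.

Variant tensalg_rel : freealg F g -> Prop :=
| TensalgRel a x y :
    tensalg_rel (freegen F (a *: x + y) - (a *: freegen F x + freegen F y)).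

Fact tensalg_rel_act (M : resModule g) s : tensalg_rel s ->
  forall m : M, free_act (@rm_act g M) s m = 0.
Proof.
have fP := free_actP (@rm_actr g M).
case=> a x y m; rewrite (alg_actB fP) (alg_actPl fP).
by rewrite !free_act_gen (rm_actl m) subrr.
Qed.

Fact tensalg_proper : 1 \notin ideal tensalg_rel.
Proof.
apply: (proper_ideal_act (free_actP (@rm_actr g trivial_module))
         (@tensalg_rel_act _) (x := (1 : F^o))).
exact: oner_neq0.
Qed.

Definition tensalg := algquot tensalg_proper.
HB.instance Definition _ := GRing.Algebra.on tensalg.
Definition tens_gen (x : g) : tensalg := algquot_pi tensalg_proper (freegen F x).

Definition tensalg_act (M : resModule g) : tensalg -> M -> M :=
  quot_act (free_act (@rm_act g M)) (S_proper := tensalg_proper).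

Lemma tensalg_actP (M : resModule g) : alg_action (@tensalg_act M).
Proof.
apply: quot_actP; [exact: free_actP (@rm_actr g M)|exact: tensalg_rel_act].
Qed.

Lemma tensalg_actE (M : resModule g) x (m : M) :
  tensalg_act (tens_gen x) m = rm_act x m.
Proof.
rewrite /tensalg_act /tens_gen quot_actE ?free_act_gen //.
  exact: free_actP (@rm_actr g M).
exact: tensalg_rel_act.
Qed.
End TensorAlgebra.

Section EnvelopingAlgebra.

Variant env_rel : tensalg -> Prop :=
| EnvRel x y : env_rel (tens_gen x * tens_gen y - tens_gen y * tens_gen x
                        - tens_gen (lie_bracket x y)).

Fact env_rel_act (M : resModule g) s : env_rel s ->
  forall m : M, tensalg_act s m = 0.
Proof.
have fP := tensalg_actP M.
case=> x y m; rewrite (alg_actB fP (_ - _)) (alg_actB fP (_ * _)).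
rewrite (alg_actM fP (tens_gen x)) (alg_actM fP (tens_gen y)).
by rewrite !tensalg_actE rm_act_bracket subrr.
Qed.

Fact env_proper : 1 \notin ideal env_rel.
Proof.
apply: (proper_ideal_act (tensalg_actP trivial_module)
         (@env_rel_act _) (x := (1 : F^o))).
exact: oner_neq0.
Qed.

Definition Uenv := algquot env_proper.
HB.instance Definition _ := GRing.Algebra.on Uenv.
Definition env_gen (x : g) : Uenv := algquot_pi env_proper (tens_gen x).

Definition Uenv_act (M : resModule g) : Uenv -> M -> M :=
  quot_act (@tensalg_act M) (S_proper := env_proper).

Lemma Uenv_actP (M : resModule g) : alg_action (@Uenv_act M).
Proof.
by apply: quot_actP; [exact: tensalg_actP|exact: env_rel_act].
Qed.

Lemma Uenv_actE (M : resModule g) x (m : M) :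
  Uenv_act (env_gen x) m = rm_act x m.
Proof.
rewrite /Uenv_act /env_gen quot_actE ?tensalg_actE //.
  exact: tensalg_actP.
exact: env_rel_act.
Qed.
End EnvelopingAlgebra.

Section RestrictedEnvelopingAlgebra.

Variant res_rel : Uenv -> Prop :=
| ResRel x : res_rel (env_gen (rl_pop x) - env_gen x ^+ p).

Fact res_rel_act (M : resModule g) s : res_rel s ->
  forall m : M, Uenv_act s m = 0.
Proof.
have fP := Uenv_actP M.
case=> x m; rewrite (alg_actB fP) (alg_actX fP) Uenv_actE rm_act_pop.
apply/eqP; rewrite subr_eq0; apply/eqP.
by apply: eq_iter => n; rewrite Uenv_actE.
Qed.

Fact res_proper : 1 \notin ideal res_rel.
Proof.
apply: (proper_ideal_act (Uenv_actP trivial_module)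
         (@res_rel_act _) (x := (1 : F^o))).
exact: oner_neq0.
Qed.

Definition Ures := algquot res_proper.
HB.instance Definition _ := GRing.Algebra.on Ures.
Definition res_gen (x : g) : Ures := algquot_pi res_proper (env_gen x).

Definition Ures_act (M : resModule g) : Ures -> M -> M :=
  quot_act (@Uenv_act M) (S_proper := res_proper).

Lemma Ures_actP (M : resModule g) : alg_action (@Ures_act M).
Proof.
by apply: quot_actP; [exact: Uenv_actP|exact: res_rel_act].
Qed.

Lemma Ures_actE (M : resModule g) x (m : M) :
  Ures_act (res_gen x) m = rm_act x m.
Proof.
rewrite /Ures_act /res_gen quot_actE ?Uenv_actE //.
  exact: Uenv_actP.
exact: res_rel_act.
Qed.
End RestrictedEnvelopingAlgebra.

End RestrictedLie.

Section UresModule.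
Context (F : fieldType) (p : nat) (charF : p \in [pchar F]).
Context (g : abrLieAlg F p) (M : resModule g).

(* A restricted g-module, viewed as a unital module over Ures charF g *)
Definition over_Ures of p \in [pchar F] : Type := M.
Local Notation MU := (over_Ures charF).
HB.instance Definition _ := GRing.Zmodule.copy MU M.

Let scale (u : Ures charF g) (m : MU) : MU := Ures_act u (m : M).
Let actP := Ures_actP charF M.

Fact over_Ures_scaleA u v m : scale u (scale v m) = scale (u * v) m.
Proof. by rewrite /scale (alg_actM actP). Qed.
Fact over_Ures_scale1 : left_id 1 scale.
Proof. by move=> m; apply: (alg_act1 actP). Qed.
Fact over_Ures_scaleDr : right_distributive scale +%R.
Proof. by move=> u; apply: (linD (alg_actPr actP u)). Qed.
Fact over_Ures_scaleDl m : {morph scale^~ m : u v / u + v}.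
Proof. exact: (linD (alg_actPl actP m)). Qed.
HB.instance Definition _ := GRing.Zmodule_isLmodule.Build (Ures charF g) MU
  over_Ures_scaleA over_Ures_scale1 over_Ures_scaleDr over_Ures_scaleDl.
End UresModule.

Section Cochains.
Context (F : fieldType) (p : nat) (charF : p \in [pchar F]).
Context (frobB : bijective (pFrobenius_aut charF)).
Context (g : abrLieAlg F p) (k : nat).

(* The pairs (t, s) with 2 t + s = k *)
Definition chain_idx := {ts : 'I_k.+1 * 'I_k.+1 | (2 * ts.1 + ts.2 == k)%N}.
HB.instance Definition _ := Finite.on chain_idx.

Definition chain : lmodType (Ures charF g) :=
  dirsum (fun i : chain_idx =>
    freeon (Ures charF g)
      (tensor (SymPow (val i).1 (twist g frobB)) (ExtPow (val i).2 g))).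

Context (M : resModule g).

Definition Ures_linear : {pred chain -> M} := fun f =>
  `[< linear (f : chain -> over_Ures M charF) >].

Lemma Ures_linearP (f : chain -> M) :
  reflect (forall u x y, f (u *: x + y) = Ures_act u (f x) + f y)
          (f \in Ures_linear).
Proof. exact: asboolP. Qed.

Fact Ures_linear_submod : submod_closed Ures_linear.
Proof.
have aP := Ures_actP charF M; split.
  by apply/Ures_linearP => u x y; rewrite (lin0 (alg_actPr aP u)) addr0.
move=> a f h /Ures_linearP fP /Ures_linearP hP; apply/Ures_linearP => u x y.
rewrite -[LHS]/(a *: f (u *: x + y) + h (u *: x + y)) fP hP.
by rewrite (alg_actPr aP u) scalerDr addrACA.
Qed.
HB.instance Definition _ :=
  GRing.isSubmodClosed.Build F (chain -> M) Ures_linear Ures_linear_submod.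

(* Hom_Ures(chain, M), a vector space over F through the one of M *)
Record cochain := Cochain {
  cochain_val :> chain -> M;
  _ : cochain_val \in Ures_linear
}.
HB.instance Definition _ := [isSub for cochain_val].
HB.instance Definition _ := [Choice of cochain by <:].
HB.instance Definition _ := [SubChoice_isSubLmodule of cochain by <:].

End Cochains.

(* Main.v *)
Require Import Defs.
From mathcomp Require Import all_fingroup all_boot all_algebra.
From mathcomp Require Import finmap monalg.
From mathcomp Require Import boolp.
From mathcomp Require Import zify.

(* A cochain is determined by its values on the free generators of the chains,
   so C^k(g; M) has a basis indexed by a basis of the direct sum over
   2 t + s = k of S^t (g-bar) tensor Lambda^s g, times a basis of M.  Bases of
   the symmetric and exterior powers are given by the weakly and the strictly
   increasing tuples of basis vectors; linear independence comes from explicit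
   dual functionals: sums over the rearrangements of a tuple in the symmetric
   case, determinants in the exterior case.  The count of indices is the
   coefficient of x^k in (1 - x^2)^-n (1 + x)^n = (1 - x)^-n. *)

Set Implicit Arguments.
Unset Strict Implicit.
Unset Printing Implicit Defensive.

(** * The counting identity, by generating functions *)

(* The coefficient of x^k in h(x^2) f(x). *)
Definition conv2 (h f : nat -> nat) (k : nat) : nat :=
  \sum_(t < k.+1 | 2 * t <= k) h t * f (k - 2 * t).

(** Brings sums for different [k] to a common index range; the added indices violate 2t <= k. *)
Lemma conv2_widen h f k N : k < N ->
  conv2 h f k = \sum_(t < N | 2 * t <= k) h t * f (k - 2 * t).
Proof.
move=> kN; rewrite /conv2.
rewrite (big_ord_widen_cond N (fun t => 2 * t <= k) (fun t => h t * f (k - 2 * t))) //.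
by apply: eq_bigl => t; lia.
Qed.

(** Splits h(x^2) into h(0) plus x^2 times the shifted series taken at x^2. *)
Lemma conv2_recl h f k :
  conv2 h f k.+2 = h 0 * f k.+2 + conv2 (h \o succn) f k.
Proof.
rewrite (@conv2_widen (h \o succn) f k k.+2) // {1}/conv2 big_mkcond big_ord_recl.
rewrite muln0 subn0 [in RHS]big_mkcond; congr (_ + _).
by apply: eq_bigr => t _; rewrite /= /bump add1n mulnS.
Qed.

Lemma conv2Dl h h' f k :
  conv2 (fun t => h t + h' t) f k = conv2 h f k + conv2 h' f k.
Proof. by rewrite -big_split; apply: eq_bigr => t _ /=; rewrite mulnDl. Qed.

(** Pascal's rule, that is (1 + x)^(n+1) = (1 + x)^n + x (1 + x)^n. *)
Lemma conv2_binS h n k :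
  conv2 h (binomial n.+1) k.+1 = conv2 h (binomial n) k.+1 + conv2 h (binomial n) k.
Proof.
rewrite [conv2 _ _ k](@conv2_widen _ _ k k.+2) // /conv2 !(big_mkcond (fun t : 'I__ => _ <= _)).
rewrite -big_split; apply: eq_bigr => t _ /=.
have [tk|kt] := leqP (2 * t) k.
  by rewrite leqW // -mulnDr subSn // binS.
(* In the remaining case 2t = k + 1: both binomial coefficients are 1 and the second sum has no
   term. *)
by case: ifP => // tk1; rewrite (_ : k.+1 - 2 * t = 0) ?bin0 ?addn0 //; lia.
Qed.

(** The coefficient of x^t in (1 - x)^-n, which counts multisets of size t; truncated subtraction
    gives the right value 1 at n = t = 0. *)
Definition multichoose n t := 'C(n + t - 1, t).

Lemma multichooseS n t :
  multichoose n.+1 t.+1 = multichoose n t.+1 + multichoose n.+1 t.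
Proof. by rewrite /multichoose !addSn addnS !subn1 /= binS. Qed.

Lemma conv2_multichoose n k :
  conv2 (multichoose n) (binomial n) k = multichoose n k.
Proof.
have mc0 l : multichoose l 0 = 1 by rewrite /multichoose bin0.
have conv20 h f : conv2 h f 0 = h 0 * f 0.
  by rewrite /conv2 big_mkcond big_ord1.
have conv21 h f : conv2 h f 1 = h 0 * f 1.
  by rewrite /conv2 big_mkcond !big_ord_recl big_ord0 /bump /= muln0 !addn0.
elim: n k => [|n IHn] k.
  have mc0S t : multichoose 0 t.+1 = 0 by rewrite /multichoose bin_small; lia.
  rewrite /conv2 big_mkcond big_ord_recl big1 /=.
    by rewrite mc0 subn0 addn0 mul1n; case: k => [|k]; rewrite ?mc0 ?mc0S.
  by move=> t _; case: ifP => // _; rewrite /bump /= add1n mc0S.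
elim: k => [|k IHk]; first by rewrite conv20 !mc0 bin0.
rewrite multichooseS -IHn -IHk conv2_binS.
(* [conv2_recl] starts in degree 2, so degree 1 is computed directly. *)
case: k {IHk} => [|k]; first by rewrite !conv21 !conv20 !mc0 !bin0.
(* For the series A = (1 - x^2)^-(n+1) (1 + x)^n, cancelling the coefficient of degree k + 1 leaves
   A - x^2 A = (1 - x^2)^-n (1 + x)^n in degree k + 2. *)
rewrite [conv2 _ (binomial n.+1) k.+1]conv2_binS addnCA addnC.
congr (_ + _); rewrite conv2_recl (conv2_recl (multichoose n)) !mc0 -addnA; congr (_ + _).
rewrite -conv2Dl; by apply: eq_bigr => t _ /=; rewrite multichooseS.
Qed.

Import GRing.Theory.
Local Open Scope ring_scope.

(** * Bases with dual coordinate functionals *)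

Section Bases.
Context (F : fieldType).
Implicit Types V W : lmodType F.

Definition linear_closed V (P : V -> Prop) : Prop :=
  P 0 /\ forall (a : F) u v, P u -> P v -> P (a *: u + v).

(** Spanning as an induction principle over subspaces, which also serves infinite families such as
    the generators of a free module. *)
Definition generates V (I : Type) (b : I -> V) : Prop :=
  forall P, linear_closed P -> (forall i, P (b i)) -> forall v, P v.

(** Duality with the functionals [c] encodes linear independence. *)
Record is_basis V (I : finType) (b : I -> V) (c : I -> V -> F) : Prop := IsBasis {
  coord_linear : forall i, linear (c i : V -> F^o);
  basis_coordE : forall i j, c i (b j) = (i == j)%:R;
  basis_gen : generates b
}.

Lemma linear_closedZ V (P : V -> Prop) : linear_closed P ->
  forall a v, P v -> P (a *: v).
Proof. by move=> [P0 Plin] a v Pv; rewrite -[_ *: _]addr0; apply: Plin. Qed.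

Lemma linear_closedD V (P : V -> Prop) : linear_closed P ->
  forall u v, P u -> P v -> P (u + v).
Proof. by move=> [_ Plin] u v Pu Pv; rewrite -[u]scale1r; apply: Plin. Qed.

Lemma linear_closed_sum V (P : V -> Prop) : linear_closed P ->
  forall (I : Type) (r : seq I) (f : I -> V),
  (forall i, P (f i)) -> P (\sum_(i <- r) f i).
Proof.
move=> Pc I r f Pf; elim/big_ind: _ => //; first by case: Pc.
exact: linear_closedD.
Qed.

Lemma linear_closed_comp V W (f : V -> W) (P : W -> Prop) :
  linear f -> linear_closed P -> linear_closed (fun v => P (f v)).
Proof.
move=> fl [P0 Plin]; split=> [|a u v Pu Pv]; first by rewrite (lin0 fl).
by rewrite fl; apply: Plin.
Qed.

Lemma linear_closed_eq V W (f h : V -> W) :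
  linear f -> linear h -> linear_closed (fun v => f v = h v).
Proof.
move=> fl hl; split=> [|a u v fu fv]; first by rewrite (lin0 fl) (lin0 hl).
by rewrite fl hl fu fv.
Qed.

Lemma generates_image V W (I : Type) (f : V -> W) (b : I -> V) :
  linear f -> (forall w, exists v, w = f v) -> generates b ->
  generates (f \o b).
Proof.
move=> fl fsurj bg P Pc Pb w; have [v ->] := fsurj w.
exact: (bg _ (linear_closed_comp fl Pc)).
Qed.

Lemma linear_sumE V W (f : V -> W) : linear f ->
  forall (I : Type) (r : seq I) (v : I -> V),
  f (\sum_(i <- r) v i) = \sum_(i <- r) f (v i).
Proof. by move=> fl I r v; rewrite (big_morph f (linD fl) (lin0 fl)). Qed.

Lemma basis_sum V (I : finType) (b : I -> V) c : is_basis b c ->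
  forall v, v = \sum_i c i v *: b i.
Proof.
move=> bc; apply: (basis_gen bc) => [|i].
  apply: (@linear_closed_eq _ _ id) => // a u v.
  rewrite scaler_sumr -big_split; apply: eq_bigr => i _ /=.
  by rewrite (coord_linear bc) scalerDl scalerA.
rewrite (bigD1 i) //= (basis_coordE bc) eqxx scale1r big1 ?addr0 // => j /negPf ji.
by rewrite (basis_coordE bc) ji scale0r.
Qed.

Lemma basis_has_dim V (I : finType) (b : I -> V) c :
  is_basis b c -> has_dim V #|I|.
Proof.
move=> bc; have cl := coord_linear bc; constructor.
exists (fun v => \row_i c (enum_val i) v).
  by move=> a u v; apply/rowP => i; rewrite !mxE cl.
exists (fun r : 'rV[F]_#|I| => \sum_(i : I) r 0 (enum_rank i) *: b i) => [v|r].
  rewrite [RHS](basis_sum bc); apply: eq_bigr => i _.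
  by rewrite mxE enum_rankK.
apply/rowP => j; rewrite mxE (linear_sumE (cl _)).
rewrite (bigD1 (enum_val j)) //= (linZ (cl _)) (basis_coordE bc) eqxx enum_valK.
rewrite [_ *: _]mulr1 big1 ?addr0 // => i /negPf ij.
by rewrite (linZ (cl _)) (basis_coordE bc) eq_sym ij [_ *: _]mulr0.
Qed.

Lemma has_dim_basis V d : has_dim V d ->
  exists (b : 'I_d -> V) c, is_basis b c.
Proof.
case=> -[f fl [h fK hK]].
exists (fun i => h (delta_mx 0 i)), (fun i v => f v 0 i); split=> [i a u v|i j|].
- by rewrite fl !mxE.
- by rewrite hK mxE eqxx.
move=> P Pc Pb v; rewrite -[v]fK [f v]row_sum_delta.
have hl : linear h by move=> a x y; rewrite -[x in LHS]hK -[y in LHS]hK -fl fK.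
rewrite (linear_sumE hl); apply: linear_closed_sum => // i.
by rewrite (linZ hl); apply: linear_closedZ.
Qed.

End Bases.

(** For spaces where spanning is hard to see directly: [v] and the combination of the [b i] with
    coefficients [c i v] have the same coordinates, hence agree. *)
Lemma basis_of_separating (F : fieldType) (V : lmodType F) (I : finType)
    (b : I -> V) (c : I -> V -> F) :
  (forall i, linear (c i : V -> F^o)) ->
  (forall i j, c i (b j) = (i == j)%:R) ->
  (forall u v, (forall i, c i u = c i v) -> u = v) ->
  is_basis b c.
Proof.
move=> cl cb sep; split=> // P Pc Pb v.
have -> : v = \sum_i c i v *: b i.
  apply: sep => i; rewrite (linear_sumE (cl i)) (bigD1 i) //=.
  rewrite (linZ (cl i)) cb eqxx [_ *: _]mulr1 big1 ?addr0 // => j /negPf ji.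
  by rewrite (linZ (cl i)) cb eq_sym ji [_ *: _]mulr0.
by apply: linear_closed_sum => // i; apply: linear_closedZ.
Qed.

Lemma coord_separating (F : fieldType) (V : lmodType F) (I : finType)
    (b : I -> V) (c : I -> V -> F) : is_basis b c ->
  forall u v, (forall i, c i u = c i v) -> u = v.
Proof.
move=> bc u v uv; rewrite (basis_sum bc u) (basis_sum bc v).
by apply: eq_bigr => i _; rewrite uv.
Qed.

(** * Linear maps out of quotients *)

Section QuotientLift.
Context (F : fieldType) (V N : lmodType F) (A : V -> Prop) (f : V -> N).
Hypotheses (f_linear : linear f) (fA : forall x, A x -> f x = 0).

Definition lquot_lift (q : V %/span A) : N := f (repr q).

(** The chosen representative differs from [v] by a combination of elements of [A], all killed by
    [f]. *)
Lemma lquot_lift_pi v : lquot_lift (lquot_pi A v) = f v.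
Proof.
rewrite /lquot_lift -[repr _](subrK v) (linD f_linear) -[RHS]add0r.
congr (_ + _); have /asboolP[s sA ->] := repr_lquot A v.
rewrite (linear_sumE f_linear) big_seq big1 // => x /sA Ax.
by rewrite (linZ f_linear) fA ?scaler0.
Qed.

Lemma lquot_lift_linear : linear lquot_lift.
Proof.
move=> a x y; rewrite -[x]lquot_piK -[y]lquot_piK -lquot_pi_linear.
by rewrite !lquot_lift_pi f_linear.
Qed.
End QuotientLift.

Lemma lquot_pi_surj (F : fieldType) (V : lmodType F) (A : V -> Prop)
  (q : V %/span A) : exists v, q = lquot_pi A v.
Proof. by exists (repr q); rewrite lquot_piK. Qed.

Lemma malg_gen (F : fieldType) (K : choiceType) :
  generates (fun k : K => << k >> : {malg F[K]}).
Proof.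
move=> P Pc Pb z; rewrite [z]monalgE; apply: linear_closed_sum => // k.
by rewrite malgUZ; apply: linear_closedZ.
Qed.

(** * Bases of tensor products *)

Section TensorBasis.
Context (F : fieldType) (V W : lmodType F).

Lemma tens_gen (I J : Type) (b : I -> V) (b' : J -> W) :
  generates b -> generates b' ->
  generates (fun ij : I * J => tens (b ij.1) (b' ij.2)).
Proof.
move=> bg bg' P Pc Pb.
(* Pure tensors are reached by varying one factor at a time. *)
have Ptens v w : P (tens v w).
  move: v; apply: bg => [|i]; first exact/linear_closed_comp/Pc/tens_linearl.
  move: w; apply: bg' => [|j]; first exact/linear_closed_comp/Pc/tens_linearr.
  exact: (Pb (i, j)).
apply: (generates_image (lquot_pi_linear _) (@lquot_pi_surj _ _ _)
  (@malg_gen _ _) Pc) => -[v w] /=.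
by have := Ptens v w; rewrite /tens locked_withE.
Qed.

Lemma tensor_basis (I J : finType) (b : I -> V) c (b' : J -> W) c' :
  is_basis b c -> is_basis b' c' ->
  is_basis (fun ij : I * J => tens (b ij.1) (b' ij.2))
    (fun ij z => tensor_lift (fun v w => c ij.1 v * c' ij.2 w : F^o) z).
Proof.
move=> bc bc'.
have hl i j w : linear (fun v => c i v * c' j w : F^o).
  by move=> a u v; rewrite (coord_linear bc) mulrDl -mulrA.
have hr i j v : linear (fun w => c i v * c' j w : F^o).
  by move=> a u w; rewrite (coord_linear bc') mulrDr mulrCA.
split=> [[i j]|[i j] [i' j']|].
- exact: tensor_lift_linear.
- by rewrite tensor_liftE //= (basis_coordE bc) (basis_coordE bc') -natrM mulnb.
- exact: (tens_gen (basis_gen bc) (basis_gen bc')).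
Qed.

End TensorBasis.

(** * Tensor powers and multilinear maps *)

Section Tpow.
Context (F : fieldType) (t : nat) (V : lmodType F).
Implicit Type w : {ffun 'I_t -> V}.

Definition multilinear (N : lmodType F) (h : {ffun 'I_t -> V} -> N) : Prop :=
  forall w i, linear (fun v => h (subst_at w i v)).

Lemma tprod_multilinear : multilinear (@tprod F t V).
Proof.
move=> w i a u v; rewrite /tprod locked_withE -linearP; apply/lquot_eqP.
exact/mem_span/Multilin.
Qed.

Lemma subst_at_id w i : subst_at w i (w i) = w.
Proof. by apply/ffunP => j; rewrite ffunE; case: eqP => [->|]. Qed.

Lemma subst_atC w i j u v : i != j ->
  subst_at (subst_at w i u) j v = subst_at (subst_at w j v) i u.
Proof.
move=> ij; apply/ffunP => l; rewrite !ffunE.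
by case: eqP => // ->; rewrite eq_sym (negPf ij).
Qed.

Lemma tprod_gen (I : Type) (b : I -> V) : generates b ->
  generates (fun phi : {ffun 'I_t -> I} => tprod [ffun i => b (phi i)]).
Proof.
move=> bg P Pc Pb.
suff Ptprod w : P (tprod w).
  apply: (generates_image (lquot_pi_linear _) (@lquot_pi_surj _ _ _)
    (@malg_gen _ _) Pc) => w /=.
  by have := Ptprod w; rewrite /tprod locked_withE.
(* Slots below [j] hold arbitrary vectors and the others generators; raising [j] to [t] frees all
   slots. *)
have Psub j : (j <= t)%N -> forall w,
    (forall i : 'I_t, (j <= i)%N -> exists l, w i = b l) -> P (tprod w).
  elim: j => [_ {}w wb|j IHj jt {}w wb].
    have [phi phiP] := choice (fun i => wb i (leq0n i)).
    have -> : w = [ffun i => b ([ffun i => phi i] i)] by apply/ffunP => i; rewrite !ffunE.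
    exact: Pb.
  rewrite -(subst_at_id w (Ordinal jt)); move: (w _).
  apply: bg => [|l]; first exact/linear_closed_comp/Pc/tprod_multilinear.
  apply: (IHj (ltnW jt)) => i ij; rewrite ffunE; case: eqP => [_|/eqP ni].
    by exists l.
  by apply: wb; rewrite ltn_neqAle ij eq_sym andbT.
by apply: (Psub t) => // i; rewrite leqNgt ltn_ord.
Qed.

Lemma tpow_lift_subproof (N : lmodType F) (h : {ffun 'I_t -> V} -> N) :
  multilinear h -> forall z, multilin_rel z -> lext h z = 0.
Proof.
move=> hm z [w i a u v]; rewrite linearB linearP /= !lextU.
by apply/eqP; rewrite subr_eq0; apply/eqP; exact: hm.
Qed.

Definition tpow_lift (N : lmodType F) (h : {ffun 'I_t -> V} -> N) :
  tpow t V -> N := lquot_lift (lext h).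

Lemma tpow_liftE (N : lmodType F) (h : {ffun 'I_t -> V} -> N) :
  multilinear h -> forall w, tpow_lift h (tprod w) = h w.
Proof.
move=> hm w; rewrite /tprod locked_withE /tpow_lift lquot_lift_pi ?lextU //.
  exact: lext_linear.
exact: tpow_lift_subproof.
Qed.

Lemma tpow_lift_linear (N : lmodType F) (h : {ffun 'I_t -> V} -> N) :
  multilinear h -> linear (tpow_lift h).
Proof.
move=> hm; apply: lquot_lift_linear; first exact: lext_linear.
exact: tpow_lift_subproof.
Qed.

End Tpow.

(** * Bases of symmetric and exterior powers *)

Section PowerBases.
Context (F : fieldType) (t : nat) (V : lmodType F) (n : nat).
Context (b : 'I_n -> V) (c : 'I_n -> V -> F) (bc : is_basis b c).
Implicit Types (w : {ffun 'I_t -> V}) (phi : t.-tuple 'I_n).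

Definition btuple phi : {ffun 'I_t -> V} := [ffun i => b (tnth phi i)].

Lemma tprod_btuple_gen : generates (fun phi => tprod (btuple phi)).
Proof.
move=> P Pc Pb; apply: (tprod_gen (basis_gen bc) Pc) => phi.
have := Pb [tuple phi i | i < t]; congr (P (tprod _)).
by apply/ffunP => i; rewrite !ffunE tnth_mktuple.
Qed.

Lemma perm_tuple_act (phi tau : t.-tuple 'I_n) : perm_eq phi tau ->
  exists s : 'S_t, btuple phi = [ffun i => btuple tau (s i)].
Proof.
move=> /tuple_permP[s phiE]; exists s; apply/ffunP => i; rewrite !ffunE.
congr (b _); have -> : phi = [tuple tnth tau (s i) | i < t] by apply: val_inj.
by rewrite tnth_mktuple.
Qed.

(** Sorted tuples represent multisets of basis indices, strictly sorted ones subsets. *)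
Definition sym_idx := {tau : t.-tuple 'I_n | sorted leq (map val tau)}.
Definition ext_idx := {tau : t.-tuple 'I_n | sorted ltn (map val tau)}.

Lemma sym_idx_of phi : exists tau : sym_idx, perm_eq phi (val tau).
Proof.
pose r := relpre (val : 'I_n -> nat) leq.
have rt : total r by move=> x y; exact: leq_total.
have s : sorted leq (map val (sort_tuple r phi)) by rewrite sorted_map sort_sorted.
by exists (Sub (sort_tuple r phi) s); rewrite SubK perm_sym perm_sort.
Qed.

Lemma sorted_perm_inj (phi tau : t.-tuple 'I_n) :
  sorted leq (map val phi) -> sorted leq (map val tau) ->
  perm_eq phi tau -> phi = tau.
Proof.
move=> sp st pt; apply: val_inj; apply: (inj_map val_inj).
apply: (sorted_eq leq_trans anti_leq sp st); exact: perm_map.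
Qed.

(** Summing over distinct rearrangements of [tau] instead of all permutations gives the value 1 at
    [tau] itself; a permanent would give a product of factorials, possibly zero in positive
    characteristic. *)
Definition sym_coord (tau : sym_idx) w : F^o :=
  \sum_(phi : t.-tuple 'I_n | perm_eq phi (val tau))
    \prod_i c (tnth phi i) (w i).

Lemma sym_coord_multilinear tau : multilinear (sym_coord tau).
Proof.
move=> w i a u v; rewrite /sym_coord scaler_sumr -big_split /=.
apply: eq_bigr => phi _; rewrite ![\prod_(j < t) _](bigD1 i) //= !ffunE eqxx.
rewrite (coord_linear bc) mulrDl [a *: (_ * _)]mulrA; congr (_ * _ + _ * _).
  by apply: eq_bigr => j /negPf ji; rewrite !ffunE ji.
by apply: eq_bigr => j /negPf ji; rewrite !ffunE ji.
Qed.

(** Permuting positions maps the set of rearrangements of [tau] to itself, so the sum is only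
    reindexed. *)
Lemma sym_coord_perm tau w (s : 'S_t) :
  sym_coord tau [ffun i => w (s i)] = sym_coord tau w.
Proof.
rewrite /sym_coord.
pose act (u : 'S_t) phi := [tuple tnth phi (u i) | i < t].
have actK (u u' : 'S_t) : cancel u u' -> cancel (act u') (act u).
  by move=> uK phi; apply: eq_from_tnth => i; rewrite !tnth_mktuple uK.
rewrite [LHS](reindex_onto (act s) (act s^-1%g)) => [|phi _]; last first.
  exact/(actK s)/permK.
have perm_act u phi : perm_eq (act u phi) phi by apply/tuple_permP; exists u.
apply: eq_big => [phi|phi _].
  rewrite (actK s^-1%g s (permKV s)) eqxx andbT.
  by rewrite (permPl (perm_act _ _)).
rewrite [RHS](reindex_inj (@perm_inj _ s)); apply: eq_bigr => i _.
by rewrite ffunE tnth_mktuple.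
Qed.

Lemma sym_coord_btuple (tau tau' : sym_idx) :
  sym_coord tau (btuple (val tau')) = (tau == tau')%:R.
Proof.
(* Only the tuple [val tau'] contributes, and it is a rearrangement of [tau] only if the two sorted
   tuples coincide. *)
have prodE phi : \prod_i c (tnth phi i) (btuple (val tau') i)
    = if phi == val tau' then 1 else 0.
  case: eqP => [->|/eqP ne].
    by rewrite big1 // => i _; rewrite ffunE (basis_coordE bc) eqxx.
  have /existsP[i ne_i] : [exists i, tnth phi i != tnth (val tau') i].
    rewrite -negb_forall; apply: contra ne => /forallP eqi.
    by apply/eqP/eq_from_tnth => i; exact/eqP.
  by rewrite (bigD1 i) //= ffunE (basis_coordE bc) (negPf ne_i) mul0r.
rewrite /sym_coord; under eq_bigr => phi _ do rewrite prodE.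
rewrite -big_mkcondr /=.
have [->|ne] := eqVneq tau tau'.
  rewrite (bigD1 (val tau')) ?eqxx ?perm_refl //= big1 ?addr0 //.
  by move=> i /andP[/andP[_ ->]].
rewrite big1 // => phi /andP[pt /eqP phiE]; case/eqP: ne; apply/esym/val_inj.
by apply: sorted_perm_inj (valP tau') (valP tau) _; move: pt; rewrite phiE.
Qed.

(** The symmetric functionals descend to the quotient and give independence; generation holds
    because sorting a tuple leaves its class unchanged. *)
Lemma sym_basis : is_basis
  (fun tau : sym_idx => lquot_pi (@sym_rel F t V) (tprod (btuple (val tau))) : SymPow t V)
  (fun tau => lquot_lift (tpow_lift (sym_coord tau))).
Proof.
have ml := sym_coord_multilinear.
have killed tau z : sym_rel z -> tpow_lift (sym_coord tau) z = 0.
  case=> w s; have ll := tpow_lift_linear (ml tau).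
  rewrite -scaleN1r addrC ll !tpow_liftE // sym_coord_perm.
  by rewrite scaleN1r addNr.
split=> [tau|tau tau'|].
- exact/lquot_lift_linear/killed/tpow_lift_linear.
- rewrite lquot_lift_pi; last exact: killed.
    by rewrite tpow_liftE // sym_coord_btuple.
  exact: tpow_lift_linear.
move=> P Pc Pb; apply: (generates_image (lquot_pi_linear _)
  (@lquot_pi_surj _ _ _) tprod_btuple_gen Pc) => phi /=.
have [tau /perm_tuple_act[s ->]] := sym_idx_of phi.
rewrite (_ : lquot_pi _ _ = lquot_pi _ (tprod (btuple (val tau)))) //.
exact/lquot_eqP/mem_span/SymRel.
Qed.

Local Notation wedge w := (lquot_pi (@alt_rel F t V) (tprod w)).

Lemma wedge_alt w i j : i != j -> w i = w j -> wedge w = 0.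
Proof.
move=> ij wij; rewrite -(lin0 (@lquot_pi_linear _ _ (@alt_rel F t V))).
by apply/lquot_eqP; rewrite subr0; apply/mem_span/(AltRel ij wij).
Qed.

Lemma wedge_multilinear : multilinear (fun w => wedge w).
Proof. by move=> w i a u v; rewrite tprod_multilinear lquot_pi_linear. Qed.

(** Polarization: expand the zero product that has the sum of the two vectors in both slots [i] and
    [j]. *)
Lemma wedge_tperm w i j : i != j ->
  wedge [ffun l => w (tperm i j l)] = - wedge w.
Proof.
move=> ij; pose w2 x y := subst_at (subst_at w i x) j y.
have w2Dl x x' y : wedge (w2 (x + x') y) = wedge (w2 x y) + wedge (w2 x' y).
  by rewrite /w2 !(subst_atC _ _ _ ij) (linD (wedge_multilinear _ i)).
have w2Dr x y y' : wedge (w2 x (y + y')) = wedge (w2 x y) + wedge (w2 x y').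
  by rewrite /w2 (linD (wedge_multilinear _ j)).
have w2xx x : wedge (w2 x x) = 0.
  by apply: (wedge_alt ij); rewrite !ffunE !eqxx; case: eqP.
have w2E : w2 (w i) (w j) = w.
  apply/ffunP => l; rewrite !ffunE.
  by case: eqP => [->|_] //; case: eqP => [->|].
have w2E' : w2 (w j) (w i) = [ffun l => w (tperm i j l)].
  by apply/ffunP => l; rewrite !ffunE; case: tpermP => [->|->|/eqP/negPf -> /eqP/negPf ->] //;
    rewrite ?eqxx ?(negPf ij).
have := w2xx (w i + w j); rewrite w2Dl !w2Dr !w2xx add0r addr0 w2E w2E'.
by move/eqP; rewrite addrC addr_eq0 => /eqP.
Qed.

(** Writes [s] as a product of transpositions, each contributing a sign; for spanning, some scalar
    suffices. *)
Lemma wedge_perm w (s : 'S_t) :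
  exists a : F, wedge [ffun i => w (s i)] = a *: wedge w.
Proof.
have [ts -> dts] := prod_tpermP s.
elim: ts dts w => [_ w|[i j] ts IH /= /andP[ij dts] w].
  exists 1; rewrite scale1r; congr (wedge _); apply/ffunP => l.
  by rewrite ffunE big_nil perm1.
have [a aE] := IH dts w; exists (- a); rewrite scaleNr -aE -(wedge_tperm _ ij).
congr (wedge _); apply/ffunP => l.
by rewrite !ffunE big_cons permM.
Qed.

(** A Plücker coordinate. Determinants vanish on repeated rows in every characteristic, as the
    exterior relations demand. *)
Definition ext_coord (tau : ext_idx) w : F^o :=
  \det (\matrix_(i < t, j < t) c (tnth (val tau) j) (w i)).

Lemma ext_coord_multilinear tau : multilinear (ext_coord tau).
Proof.
move=> w i a u v; rewrite /ext_coord -[X in _ = _ + X]mul1r.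
apply: (@determinant_multilinear _ _ _ _ _ i).
- by apply/rowP => j; rewrite !mxE !ffunE !eqxx (coord_linear bc) mul1r.
- by apply/matrixP => l j; rewrite !mxE !ffunE eq_sym (negPf (neq_lift _ _)).
- by apply/matrixP => l j; rewrite !mxE !ffunE eq_sym (negPf (neq_lift _ _)).
Qed.

Lemma ext_coord_alt tau w i j : i != j -> w i = w j -> ext_coord tau w = 0.
Proof.
by move=> ij wij; apply: (determinant_alternate ij) => l; rewrite !mxE wij.
Qed.

Lemma ext_idx_sorted (tau : ext_idx) :
  uniq (val tau) /\ sorted leq (map val (val tau)).
Proof.
have := valP tau; rewrite ltn_sorted_uniq_leq => /andP[u s]; split=> //.
by rewrite (map_uniq u).
Qed.

Lemma ext_coord_btuple (tau tau' : ext_idx) :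
  ext_coord tau (btuple (val tau')) = (tau == tau')%:R.
Proof.
have [u s] := ext_idx_sorted tau; have [u' s'] := ext_idx_sorted tau'.
have [<-|ne] := eqVneq tau tau'.
  rewrite /ext_coord (_ : \matrix_(_, _) _ = 1%:M) ?det1 //.
  apply/matrixP => i j; rewrite !mxE ffunE (basis_coordE bc) eq_sym.
  by rewrite (inj_eq (tuple_uniqP _ u)).
(* Of two sets of size [t] neither contains the other properly; so for distinct tuples some entry
   [x] of [tau] is missing from [tau'], and its column is zero. *)
have [/allP sub|/allPn[x xt xt']] := boolP (all (mem (val tau')) (val tau)).
  case/eqP: ne; apply/val_inj/sorted_perm_inj => //; apply: uniq_perm => //.
  by have [] := uniq_min_size u sub; rewrite ?size_tuple.
have /tnthP[j xE] := xt.
rewrite /ext_coord (expand_det_col _ j) big1 // => i _; rewrite !mxE ffunE.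
rewrite -xE (basis_coordE bc); case: eqP => [xi|_]; last by rewrite mul0r.
by case/negP: xt'; rewrite /= xi mem_tnth.
Qed.

Lemma ext_basis : is_basis
  (fun tau : ext_idx => lquot_pi (@alt_rel F t V) (tprod (btuple (val tau))) : ExtPow t V)
  (fun tau => lquot_lift (tpow_lift (ext_coord tau))).
Proof.
have ml := ext_coord_multilinear.
have killed tau z : alt_rel z -> tpow_lift (ext_coord tau) z = 0.
  by case=> w i j ij wij; rewrite tpow_liftE // (ext_coord_alt _ ij wij).
split=> [tau|tau tau'|].
- exact/lquot_lift_linear/killed/tpow_lift_linear.
- rewrite lquot_lift_pi; last exact: killed.
    by rewrite tpow_liftE // ext_coord_btuple.
  exact: tpow_lift_linear.
move=> P Pc Pb; apply: (generates_image (lquot_pi_linear _)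
  (@lquot_pi_surj _ _ _) tprod_btuple_gen Pc) => phi /=.
(* A tuple with a repeated entry has zero wedge; any other becomes strictly increasing by sorting,
   at the cost of a scalar. *)
have [u|] := boolP (uniq phi); last first.
  move=> /tuple_uniqP inj; have /injectivePn[i [j ij eij]] : ~~ injectiveb (tnth phi).
    by apply/injectiveP.
  rewrite (wedge_alt ij); first by case: Pc.
  by rewrite !ffunE eij.
have [[tau st] pt] := sym_idx_of phi.
have lt : sorted ltn (map val tau).
  by rewrite ltn_sorted_uniq_leq st andbT map_inj_uniq -?(perm_uniq pt) //; exact: val_inj.
have [s ->] := perm_tuple_act pt.
have [a ->] := wedge_perm (btuple tau) s.
exact/(linear_closedZ Pc)/(Pb (Sub tau lt)).
Qed.

End PowerBases.

Lemma card_sym_idx t n : #|{: sym_idx t n}| = 'C(n + t - 1, t).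
Proof.
rewrite card_sig -cardsE; case: n => [|n].
  (* Without basis vectors only the empty tuple exists; truncated subtraction yields ['C(0, 0)],
     which is 1, and ['C(t, t.+1)], which is 0. *)
  case: t => [|t].
    by rewrite (@eq_card1 _ [tuple]) // => x; rewrite [x]tuple0 !inE.
  by rewrite bin_small ?subn1 // eq_card0 //; case/tupleP=> [[]].
by rewrite card_sorted_tuples addSn subn1 addnC.
Qed.

Lemma card_ext_idx t n : #|{: ext_idx t n}| = 'C(n, t).
Proof. by rewrite card_sig -cardsE card_ltn_sorted_tuples. Qed.

(** * The Frobenius twist *)

Section TwistBasis.
Context (F : fieldType) (p : nat) (charF : p \in [pchar F]).
Context (frobB : bijective (pFrobenius_aut charF)) (V : lmodType F).

(** Scalars act on the twist through p-th roots, so p-th powers of coordinates are linear there; the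
    same vectors span because every scalar is a p-th root. *)
Lemma twist_basis (I : finType) (b : I -> V) c : is_basis b c ->
  is_basis (b : I -> twist V frobB) (fun i v => pFrobenius_aut charF (c i v)).
Proof.
have frobM x y : pFrobenius_aut charF (x * y)
    = pFrobenius_aut charF x * pFrobenius_aut charF y.
  by rewrite pFrobenius_autM_comm //; exact: mulrC.
move=> bc; split=> [i a u v|i j|].
- rewrite [c i _](coord_linear bc) pFrobenius_autD_comm; last exact: mulrC.
  by rewrite frobM prootK.
- by rewrite (basis_coordE bc) pFrobenius_aut_nat.
move=> P [P0 Pc] Pb; apply: (basis_gen bc) => //; split=> // a u v Pu Pv.
have <- : proot frobB (pFrobenius_aut charF a) = a.
  by apply: (bij_inj frobB); exact: prootK.
exact: Pc.
Qed.
End TwistBasis.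

(** * Direct sums and free modules *)

Section DirsumInjection.
Context (R : pzRingType) (I : finType) (V : I -> lmodType R).

Definition dirsum_in (i : I) (x : V i) : dirsum V := dfwith (0 : dirsum V) x.

Lemma dirsum_in_same i (x : V i) : dirsum_in x i = x.
Proof. exact: dfwith_in. Qed.

Lemma dirsum_in_other i j (x : V i) : i != j -> dirsum_in x j = 0.
Proof. by move=> ij; rewrite /dirsum_in dfwith_out. Qed.

Lemma dirsum_in_linear i : linear (@dirsum_in i).
Proof.
move=> a x y; apply: functional_extensionality_dep => j.
rewrite -[RHS]/(a *: dirsum_in x j + dirsum_in y j).
have [<-|ij] := eqVneq i j; first by rewrite !dirsum_in_same.
by rewrite !dirsum_in_other // scaler0 addr0.
Qed.

Lemma dirsum_sum (x : dirsum V) : x = \sum_i dirsum_in (x i).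
Proof.
apply: functional_extensionality_dep => j.
rewrite (big_morph (fun y : dirsum V => y j) (id1 := 0) (op1 := +%R)) //.
rewrite (bigD1 j) //= dirsum_in_same big1 ?addr0 // => i ij.
exact: dirsum_in_other.
Qed.
End DirsumInjection.

Section FreeonLift.
Context (F : fieldType) (A : algType F) (X N : lmodType F).

(** Moves a scalar across the tensor into the algebra, where maps linear over [A] can extract it. *)
Lemma tens_unit_linear (a : F) (x y : X) :
  tens (a *: x + y) (1 : A) = tens x a%:A + tens y 1.
Proof. by rewrite (tens_linearl 1) (linZ (tens_linearr x)). Qed.

Context (act : A -> N -> N) (actP : alg_action act).
Context (h : X -> N) (h_linear : linear h).

(** The universal property of the free module on [X]: extends [h] from the tensors [tens x 1]. *)
Definition freeon_lift (z : freeon A X) : N :=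
  tensor_lift (fun x u => act u (h x)) z.

Let act_h_l u : linear (fun x => act u (h x)).
Proof. by move=> a x y; rewrite h_linear (alg_actPr actP). Qed.

Let act_h_r x : linear (fun u => act u (h x)).
Proof. exact: (alg_actPl actP). Qed.

Lemma freeon_lift_tens x u : freeon_lift (tens x u) = act u (h x).
Proof. exact: tensor_liftE. Qed.

Lemma freeon_liftP u z z' :
  freeon_lift (u *: z + z') = act u (freeon_lift z) + freeon_lift z'.
Proof.
have lD := linD (tensor_lift_linear act_h_l act_h_r).
(* Both sides are additive in [z], which leaves pure tensors and the multiplicativity of the
   action. *)
rewrite [LHS]lD; congr (_ + _); move: z; apply: tensor_ext => [v w|v w|x v].
- by rewrite (scalerDr u (v : freeon A X) w) [LHS]lD.
- by rewrite [freeon_lift _]lD (linD (alg_actPr actP u)).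
- rewrite freeon_lift_tens -(alg_actM actP) -freeon_lift_tens.
  by congr freeon_lift; apply: freeon_scaleE.
Qed.

Lemma freeon_lift0 : freeon_lift 0 = 0.
Proof. exact: lin0 (tensor_lift_linear act_h_l act_h_r). Qed.
End FreeonLift.

(** * Elementary cochains as a basis *)

Section CochainBasis.
Context (F : fieldType) (p : nat) (charF : p \in [pchar F]).
Context (frobB : bijective (pFrobenius_aut charF)).
Context (g : abrLieAlg F p) (k : nat) (M : resModule g).
Local Notation U := (Ures charF g).
Local Notation Y i := (tensor (SymPow (val i).1 (twist g frobB)) (ExtPow (val i).2 g)).
Context (J : chain_idx k -> finType) (L : finType).
Context (bY : forall i : chain_idx k, J i -> Y i) (cY : forall i : chain_idx k, J i -> Y i -> F).
Hypothesis bcY : forall i, is_basis (@bY i) (@cY i).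
Context (bM : L -> M) (cM : L -> M -> F).
Hypothesis bcM : is_basis bM cM.

Let aP := Ures_actP charF M.

Definition gen_chain (i : chain_idx k) (y : Y i) (u : U) : chain frobB g k :=
  dirsum_in (tens y u : freeon U (Y i)).

Lemma gen_chainZ (i : chain_idx k) (y : Y i) (u v : U) :
  u *: gen_chain y v = gen_chain y (u * v).
Proof.
rewrite /gen_chain -(freeon_scaleE u y v).
by rewrite -[freeon_scale u _]/(u *: (tens y v : freeon U (Y i))) (linZ (dirsum_in_linear (i := i))).
Qed.

Lemma cochainE (f : cochain frobB k M) u x y :
  f (u *: x + y) = Ures_act u (f x) + f y.
Proof. by case: f => f fP /=; apply: (Ures_linearP f fP). Qed.

(** Field scalars are read as multiples of 1 in [Ures], over which cochains are linear. *)
Lemma cochain_linear_gen (f : cochain frobB k M) (i : chain_idx k) :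
  linear (fun y : Y i => f (gen_chain y 1) : M).
Proof.
move=> a y z.
have -> : gen_chain (a *: y + z) 1 = a%:A *: gen_chain y 1 + gen_chain z 1.
  rewrite gen_chainZ mulr1 /gen_chain tens_unit_linear.
  exact: (linD (dirsum_in_linear (i := i))).
by rewrite cochainE (linZ (alg_actPl aP _)) (alg_act1 aP).
Qed.

Lemma cochain_ext (f h : cochain frobB k M) :
  (forall i j, f (gen_chain (@bY i j) 1) = h (gen_chain (@bY i j) 1)) -> f = h.
Proof.
move=> fh.
have addf (f' : cochain frobB k M) : {morph f' : x y / x + y}.
  by move=> x y; have := cochainE f' 1 x y; rewrite scale1r (alg_act1 aP).
have f0 (f' : cochain frobB k M) : f' 0 = 0.
  by apply: (addrI (f' 0)); rewrite -addf !addr0.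
have fZ (f' : cochain frobB k M) u x : f' (u *: x) = Ures_act u (f' x).
  by have := cochainE f' u x 0; rewrite f0 !addr0.
apply: val_inj; apply: functional_extensionality_dep => x /=.
rewrite (dirsum_sum x) (big_morph f (addf f) (f0 f)) (big_morph h (addf h) (f0 h)).
apply: eq_bigr => i _; move: (x i); apply: tensor_ext => [y z|y z|y u].
- by rewrite -addf -(linD (dirsum_in_linear (i := i))).
- by rewrite -addf -(linD (dirsum_in_linear (i := i))).
(* A pure tensor with last factor [u] is [u] times one with last factor 1. *)
rewrite -[dirsum_in _]/(gen_chain y u) -[u]mulr1 -gen_chainZ !fZ; congr Ures_act.
apply: (basis_gen (bcY i) (P := fun y => f (gen_chain y 1) = h (gen_chain y 1))) => //.
by apply: linear_closed_eq; exact: cochain_linear_gen.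
Qed.

Definition cochain_idx : finType := ({i : chain_idx k & J i} * L)%type.

Let scaled_coord (i : chain_idx k) (j : J i) l : Y i -> M :=
  fun y => cY j y *: bM l.

Let scaled_coord_linear (i : chain_idx k) (j : J i) l : linear (scaled_coord j l).
Proof.
by move=> a y z; rewrite /scaled_coord (coord_linear (bcY i)) scalerDl -scalerA.
Qed.

(** The elementary cochain that sends one free generator to a basis vector of [M] and the remaining
    generators to zero. *)
Definition cochain_basis_fun (x : cochain_idx) (z : chain frobB g k) : M :=
  freeon_lift (@Ures_act _ _ charF g M) (scaled_coord (tagged x.1) x.2) (z (tag x.1)).

Lemma cochain_basis_subproof x :
  cochain_basis_fun x \in @Ures_linear _ _ _ frobB g k M.
Proof.
apply/Ures_linearP => u y z.
exact: (freeon_liftP aP (scaled_coord_linear _ _)).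
Qed.

(** The coordinates of the values on free generators separate cochains by [cochain_ext], which takes
    the place of a spanning argument. *)
Lemma cochain_basis : is_basis
  (fun x : cochain_idx => Cochain (cochain_basis_subproof x))
  (fun x f => cM x.2 (f (gen_chain (bY (tagged x.1)) 1))).
Proof.
apply: basis_of_separating => [x a f h|[[i j] l] [[i' j'] l']|f h fh].
- have -> z : (a *: f + h) z = a *: f z + h z :> M by [].
  exact: (coord_linear bcM).
- rewrite /= /cochain_basis_fun /=.
  rewrite xpair_eqE; case: (eqVneq i i') j' => [<-|ne] j'; last first.
    (* A generator from another summand has zero component here. *)
    rewrite /gen_chain dirsum_in_other // (freeon_lift0 aP (scaled_coord_linear j' l')).
    by rewrite (lin0 (coord_linear bcM l)) -tag_eqE /tag_eq /= (negPf ne).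
  rewrite /gen_chain dirsum_in_same (freeon_lift_tens aP (scaled_coord_linear j' l')) (alg_act1 aP).
  rewrite (linZ (coord_linear bcM l)) (basis_coordE bcM) (basis_coordE (bcY i)).
  by rewrite -[LHS]/((j' == j)%:R * (l == l')%:R : F) -natrM mulnb eq_Tagged eq_sym.
- apply: cochain_ext => i j; apply: (coord_separating bcM) => l.
  exact: (fh (Tagged J j, l)).
Qed.

Lemma card_cochain_idx :
  #|cochain_idx| = (\sum_(i : chain_idx k) #|J i| * #|L|)%N.
Proof. by rewrite card_prod card_tagged sumnE big_map big_enum big_distrl. Qed.

End CochainBasis.

(** * Index count and dimension formula *)

Lemma chain_idx_sum k (h f : nat -> nat) :
  (\sum_(i : chain_idx k) h (val i).1 * f (val i).2)%N = conv2 h f k.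
Proof.
pose E (ts : 'I_k.+1 * 'I_k.+1) := (h ts.1 * f ts.2)%N.
have -> : (\sum_(i : chain_idx k) h (val i).1 * f (val i).2
    = \sum_(ts : 'I_k.+1 * 'I_k.+1 | 2 * ts.1 + ts.2 == k) E ts)%N.
  rewrite [RHS](reindex_omap (val : chain_idx k -> _) insub) => [|ts tsP].
    by apply: eq_bigl => i; rewrite valK eqxx (valP i).
  by rewrite insubT.
rewrite /conv2 [RHS]big_mkcond.
rewrite -(pair_big_dep xpredT (fun t s : 'I_k.+1 => 2 * t + s == k)%N
  (fun t s => E (t, s))) /E /=.
(* For given [t] the only candidate for [s] is k - 2t, admissible exactly when 2t <= k. *)
apply: eq_bigr => t _; case: leqP => [tk|kt].
  rewrite (eq_bigl (fun s : 'I_k.+1 => s == k - 2 * t :> nat)%N) => [|s]; last first.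
    by rewrite -[X in _ == X](subnKC tk) eqn_add2l.
  by rewrite (big_ord1_eq addn (fun s => h t * f s)%N) ltnS leq_subr.
rewrite big_pred0 // => s; apply/negbTE; rewrite neq_ltn.
by rewrite (leq_trans kt (leq_addr s _)) orbT.
Qed.

Lemma cochain_dim (F : fieldType) (p : nat) (charF : p \in [pchar F])
    (frobB : bijective (pFrobenius_aut charF))
    (g : abrLieAlg F p) (M : resModule g) (n m : nat) (k : nat) :
  has_dim g n -> has_dim M m -> has_dim (cochain frobB k M) (multichoose n k * m)%N.
Proof.
move=> /has_dim_basis[b [c bc]] /has_dim_basis[bM [cM bcM]].
(* The twisted basis has the same index set as that of [g], so one [n] governs both powers. *)
have bcY (i : chain_idx k) := tensor_basis
  (sym_basis (val i).1 (twist_basis frobB bc))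
  (ext_basis (val i).2 bc).
have := basis_has_dim (cochain_basis bcY bcM).
rewrite card_cochain_idx card_ord -big_distrl /=.
under eq_bigr => i _ do rewrite card_prod card_sym_idx card_ext_idx.
by rewrite (chain_idx_sum k (multichoose n) (binomial n)) conv2_multichoose.
Qed.

Lemma regular_basis (F : fieldType) :
  is_basis (fun _ : unit => 1 : F^o) (fun _ x => x).
Proof.
split=> [[] //|[] [] //|P Pc P1 v].
by rewrite -[v]mulr1; apply/(linear_closedZ Pc)/(P1 tt).
Qed.

Theorem corollary3p6 (F : fieldType) (p : nat) (charF : p \in [pchar F])
    (frobB : bijective (pFrobenius_aut charF))
    (g : abrLieAlg F p) (M : resModule g) (n m : nat)
    (dim_g : has_dim g n) (dim_M : has_dim M m) (k : nat) :
  has_dim (cochain frobB k M) ('C(n + k - 1, k) * m)%N /\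
  (exists d : nat, has_dim (cochain frobB k (trivial_module charF g)) d /\
                   has_dim (SymPow k g) d).
Proof.
split; first exact: cochain_dim.
have dim_F : has_dim (trivial_module charF g) 1.
  by have := basis_has_dim (regular_basis F); rewrite card_unit.
exists 'C(n + k - 1, k)%N; split.
  by have := cochain_dim frobB k dim_g dim_F; rewrite muln1.
(* This symmetric power is that of [g] itself, without the twist. *)
have [b [c bc]] := has_dim_basis dim_g.
by have := basis_has_dim (sym_basis k bc); rewrite card_sym_idx.
Qed.
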